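(* Let $n$ be any positive integer and let $Q$ be a fork with $n$ vertices and exchange matrix $B$. For each fork-preserving mutation sequence $\boldsymbol{w}$ from $Q$, the $n$-tuple of reflections $(\mathbf{r}_1^{\boldsymbol{w}},\dots,\mathbf{r}_n^{\boldsymbol{w}})$ depends only on the signs of the entries of $B$. That is: if $B=[b_{ij}]$ and $B'=[b'_{ij}]$ are two forks on $\{1,\dots,n\}$ with $\mathrm{sgn}(b_{ij})=\mathrm{sgn}(b'_{ij})$ for all $i,j$, and $\boldsymbol{w}$ is fork-preserving from both, then the tuples $(\mathbf{r}_1^{\boldsymbol{w}},\dots,\mathbf{r}_n^{\boldsymbol{w}})$ computed from $B$ and from $B'$ coincide in $\mathcal W$.
   Context: A quiver on the vertex set $\{1,\dots,n\}$ (no loops, no oriented 2-cycles) is identified with an $n\times n$ skew-symmetric integer matrix $B=[b_{ij}]$: if $b_{ij}>0$ there are $b_{ij}$ arrows from $i$ to $j$. Mutation: for an $n\times 2n$ integer matrix $M=[m_{ij}]$ and $k\in\{1,\dots,n\}$, the mutation of $M$ at $k$ is the matrix with entries $-m_{ij}$ if $i=k$ or $j=k$, and $m_{ij}+\mathrm{sgn}(m_{ik})\max(m_{ik}m_{kj},0)$ otherwise. A mutation sequence $\boldsymbol{w}=[i_1,\dots,i_\ell]$ (possibly empty) means mutating at $i_1$, then $i_2$, etc.; $\boldsymbol{w}[k]$ is $\boldsymbol{w}$ followed by $k$; $\boldsymbol{w}$ is reduced if $i_j\ne i_{j+1}$ for all $j$. Starting from $[B\mid I]$, the result after $\boldsymbol{w}$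 is written $[B^{\boldsymbol{w}}\mid C^{\boldsymbol{w}}]$ with $B^{\boldsymbol{w}}=[b_{ij}^{\boldsymbol{w}}]$; the rows $c_i^{\boldsymbol{w}}$ of $C^{\boldsymbol{w}}$ are the $c$-vectors (known to be nonzero, with all nonzero entries of one sign). For a nonzero vector $c$, $c>0$ means all entries are $\ge0$. Reflections: $\mathcal W=\langle s_1,\dots,s_n\mid s_i^2=1\rangle$ is the universal Coxeter group. Set $\mathbf{r}_i=\mathbf{r}_i^{[\,]}=s_i$ and inductively $\mathbf{r}_i^{\boldsymbol{w}[k]}=\mathbf{r}_k^{\boldsymbol{w}}\mathbf{r}_i^{\boldsymbol{w}}\mathbf{r}_k^{\boldsymbol{w}}$ if $b_{ik}^{\boldsymbol{w}}c_k^{\boldsymbol{w}}>0$, and $\mathbf{r}_i^{\boldsymbol{w}[k]}=\mathbf{r}_i^{\boldsymbol{w}}$ otherwise. A quiver is abundant if there are at least two arrows between every pair of distinct vertices. A fork is an abundant, non-acyclic quiver $F=[f_{ij}]$ with a vertex $r$ (the point of return, which is unique) such that, with $F^-(r)$ the set of vertices having arrows to $r$ and $F^+(r)$ the set of vertices receiving arrows from $r$: for all $i\in F^-(r)$, $j\in F^+(r)$ one has $f_{ji}>f_{ir}$ and $f_{ji}>f_{rj}$; and the full subquivers on $F^-(r)$ and on $F^+(r)$ are acyclic. A fork-preserving mutation sequence from a fork with point of return $r$ is a reduced mutation sequence whose first mutation (if any) is not at $r$. *)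

(* Defs.v *)
From HB Require Import structures.
From mathcomp Require Import all_boot all_order all_algebra.
From mathcomp Require Import boolp.

Set Implicit Arguments.
Unset Strict Implicit.
Unset Printing Implicit Defensive.

Import Order.TTheory GRing.Theory Num.Theory.
Local Open Scope ring_scope.

(* The universal Coxeter group < s_1, ..., s_n | s_i ^ 2 = 1 >, as the        *)
(* quotient of the words in the generators by the congruence generated by     *)
(* s_i s_i ~ 1.  Words need no formal inverses, since s_i is its own inverse. *)

Section UniversalCoxeterGroup.

Variable n : nat.
Implicit Types (i : 'I_n) (u v : seq 'I_n).

Inductive cox_cong : seq 'I_n -> seq 'I_n -> Prop :=
| cox_refl u : cox_cong u u
| cox_sym u v : cox_cong u v -> cox_cong v u
| cox_trans u v w : cox_cong u v -> cox_cong v w -> cox_cong u w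
| cox_square u i v : cox_cong (u ++ [:: i; i] ++ v) (u ++ v).

Definition cox_rel : rel (seq 'I_n) := fun u v => `[< cox_cong u v >].

Lemma cox_rel_refl : reflexive cox_rel.
Proof. by move=> u; apply/asboolP/cox_refl. Qed.

Lemma cox_rel_sym : symmetric cox_rel.
Proof. by move=> u v; apply: asbool_equiv_eq; split; apply: cox_sym. Qed.

Lemma cox_rel_trans : transitive cox_rel.
Proof.
move=> v u w /asboolP uv /asboolP vw; apply/asboolP.
exact: cox_trans uv vw.
Qed.

Canonical cox_equiv :=
  EquivRel cox_rel cox_rel_refl cox_rel_sym cox_rel_trans.

Definition coxeter : Type := {eq_quot cox_rel}%qT.

HB.instance Definition _ := Choice.on coxeter.

Definition cox_word u : coxeter := (\pi_({eq_quot cox_rel}) u)%qT.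

Lemma cox_wordP u v : cox_word u = cox_word v <-> cox_cong u v.
Proof.
split; first by move=> /eqmodP /asboolP.
by move=> uv; apply/eqmodP/asboolP.
Qed.

Lemma cox_word_repr (x : coxeter) : cox_word (repr x) = x.
Proof. exact: reprK. Qed.

Lemma cox_cong_cat u u' v v' :
  cox_cong u u' -> cox_cong v v' -> cox_cong (u ++ v) (u' ++ v').
Proof.
move=> uu' vv'; apply: (@cox_trans _ (u' ++ v)).
  elim: uu' => {u u'} [u|u u' _|u w u' _ uw _|u i w].
  - exact: cox_refl.
  - exact: cox_sym.
  - exact: cox_trans.
  - by rewrite -!catA; apply: cox_square.
elim: vv' => {v v'} [v|v v' _|v w v' _ vw _|v i w].
- exact: cox_refl.
- exact: cox_sym.
- exact: cox_trans.
- by rewrite [u' ++ v ++ _]catA [u' ++ v ++ w]catA; apply: cox_square.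
Qed.

Lemma cox_cong_rev u v : cox_cong u v -> cox_cong (rev u) (rev v).
Proof.
elim=> {u v} [u|u v _|u w v _ uw _|u i v].
- exact: cox_refl.
- exact: cox_sym.
- exact: cox_trans.
- by rewrite !rev_cat -catA; apply: cox_square.
Qed.

Lemma cox_cong_catVl u : cox_cong (rev u ++ u) [::].
Proof.
elim: u => [|i u IHu]; first exact: cox_refl.
rewrite rev_cons -cats1 -catA; apply: cox_trans IHu.
exact: (cox_square (rev u) i u).
Qed.

Definition cox_one : coxeter := cox_word [::].
Definition cox_mul (x y : coxeter) : coxeter := cox_word (repr x ++ repr y).
Definition cox_inv (x : coxeter) : coxeter := cox_word (rev (repr x)).

Lemma cox_repr_word u : cox_cong (repr (cox_word u)) u.
Proof. by apply/cox_wordP; rewrite cox_word_repr. Qed.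

Lemma cox_mulE u v : cox_mul (cox_word u) (cox_word v) = cox_word (u ++ v).
Proof. by apply/cox_wordP/cox_cong_cat; apply: cox_repr_word. Qed.

Lemma cox_invE u : cox_inv (cox_word u) = cox_word (rev u).
Proof. by apply/cox_wordP/cox_cong_rev/cox_repr_word. Qed.

Lemma cox_mulA : associative cox_mul.
Proof.
move=> x y z; rewrite -(cox_word_repr x) -(cox_word_repr y) -(cox_word_repr z).
by rewrite !cox_mulE catA.
Qed.

Lemma cox_mul1 : left_id cox_one cox_mul.
Proof. by move=> x; rewrite -(cox_word_repr x) cox_mulE. Qed.

Lemma cox_mulr1 : right_id cox_one cox_mul.
Proof. by move=> x; rewrite -(cox_word_repr x) cox_mulE cats0. Qed.

Lemma cox_mulV : left_inverse cox_one cox_inv cox_mul.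
Proof.
move=> x; rewrite -(cox_word_repr x) cox_invE cox_mulE.
exact/cox_wordP/cox_cong_catVl.
Qed.

Lemma cox_mulrV : right_inverse cox_one cox_inv cox_mul.
Proof.
move=> x; rewrite -(cox_word_repr x) cox_invE cox_mulE.
by apply/cox_wordP; rewrite -{1}(revK (repr x)); apply: cox_cong_catVl.
Qed.

HB.instance Definition _ :=
  isGroup.Build coxeter cox_mulA cox_mul1 cox_mulr1 cox_mulV cox_mulrV.

Definition cox_gen i : coxeter := cox_word [:: i].

Lemma cox_gen_square i : (cox_gen i * cox_gen i = 1)%g.
Proof.
rewrite [LHS]cox_mulE; apply/cox_wordP.
exact: (cox_square [::] i [::]).
Qed.

End UniversalCoxeterGroup.

Section Quivers.

Variable n : nat.
Implicit Types (B : 'M[int]_n) (M : 'M[int]_(n, n + n)) (r k : 'I_n).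
Implicit Types (w : seq 'I_n) (S : {set 'I_n}).

Definition is_quiver B : Prop := B^T = - B.

Definition has_arrow B : rel 'I_n := fun i j => 0 < B i j.

Definition acyclic_on B S : Prop :=
  forall p : seq 'I_n,
    p != [::] -> {subset p <= S} -> ~~ cycle (has_arrow B) p.

Definition acyclic B : Prop := acyclic_on B [set: 'I_n].

Definition abundant B : Prop :=
  forall i j : 'I_n, i != j -> 2 <= `|B i j|.

Definition in_nbrs B r : {set 'I_n} := [set i | has_arrow B i r].
Definition out_nbrs B r : {set 'I_n} := [set j | has_arrow B r j].

(* [is_fork B r]: B is a fork with point of return r. *)
Definition is_fork B r : Prop :=
  [/\ is_quiver B, abundant B, ~ acyclic B,
      (forall i j, i \in in_nbrs B r -> j \in out_nbrs B r ->
         B i r < B j i /\ B r j < B j i)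
    & acyclic_on B (in_nbrs B r) /\ acyclic_on B (out_nbrs B r)].

Definition reduced w : bool := sorted (fun i j => i != j) w.

Definition fork_preserving r w : bool := reduced w && (ohead w != Some r).

(* Column k of the left block of an n x 2n matrix is column [lshift n k]. *)
Definition mutate M k : 'M[int]_(n, n + n) :=
  \matrix_(i, j)
    if (i == k) || (j == lshift n k) then - M i j
    else M i j
         + Num.sg (M i (lshift n k)) * Num.max (M i (lshift n k) * M k j) 0.

Definition framed B w : 'M[int]_(n, n + n) := foldl mutate (row_mx B 1%:M) w.

Definition Bmut B w : 'M[int]_n := lsubmx (framed B w).
Definition Cmut B w : 'M[int]_n := rsubmx (framed B w).
Definition cvec B w i : 'rV[int]_n := row i (Cmut B w).

Definition pos_vec (c : 'rV[int]_n) : bool :=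
  (c != 0) && [forall j, 0 <= c 0 j].

(* Mutations are applied from left to right, so the recursion r^{w[k]} in     *)
(* terms of r^w peels off the last letter of the sequence, i.e. the head of   *)
(* the reversed sequence v = rev w.                                           *)
Fixpoint reflection_rev B (v : seq 'I_n) (i : 'I_n) : coxeter n :=
  if v is k :: v' then
    let w := rev v' in
    if pos_vec (Bmut B w i k *: cvec B w k)
    then (reflection_rev B v' k * reflection_rev B v' i * reflection_rev B v' k)%g
    else reflection_rev B v' i
  else cox_gen i.

Definition reflection B w (i : 'I_n) : coxeter n := reflection_rev B (rev w) i.

Definition reflections B w : n.-tuple (coxeter n) := [tuple reflection B w i | i < n].

Lemma reflection_nil B i : reflection B [::] i = cox_gen i.
Proof. by []. Qed.

Lemma reflection_rcons B w k i :
  reflection B (rcons w k) i =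
    if pos_vec (Bmut B w i k *: cvec B w k)
    then (reflection B w k * reflection B w i * reflection B w k)%g
    else reflection B w i.
Proof. by rewrite /reflection rev_rcons /= revK. Qed.

End Quivers.

(* Main.v *)
(* Mutating a fork at k <> r yields a fork with point of return k, and the signs
   of its arrows are determined by the old signs: every path i -> k -> j leaves
   an arrow i -> j.  Along a fork-preserving sequence with last mutation r, call
   i green or red when c_i is positive or negative.  Then no arrow avoiding r
   goes from red to green, and if b_ir c_r > 0 then c_i has the colour opposite
   to c_r and dominates it entrywise in absolute value.  These properties are
   kept by mutation at k <> r, and they force c_i + |b_ik| c_k to have the sign
   of c_k whenever b_ik c_k > 0: opposite colours only occur for i = r, where
   |c_k| dominates |c_r| and |b_rk| >= 2.  So all the signs that enter the
   recursion for the reflections are determined by those of B. *)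
Require Import Defs.
From mathcomp Require Import all_boot all_order all_algebra.
From mathcomp Require Import zify.

Set Implicit Arguments.
Unset Strict Implicit.
Unset Printing Implicit Defensive.

Import Order.TTheory GRing.Theory Num.Theory.
Local Open Scope ring_scope.

Section ForkMutation.

Variable n : nat.
Implicit Types (B : 'M[int]_n) (M : 'M[int]_(n, n + n)) (r k i j l : 'I_n).
Implicit Types e : 'I_n -> bool.

Local Notation b M i j := (fun_of_matrix M i (lshift n j)).
Local Notation c M i j := (fun_of_matrix M i (rshift n j)).

(** * Entrywise mutation, and the data kept of a fork *)

Lemma mutate_at M k i (j : 'I_(n + n)) :
  (i == k) || (j == lshift n k) -> mutate M k i j = - M i j.
Proof. by rewrite mxE => ->. Qed.

Section Away.

Variables (M : 'M[int]_(n, n + n)) (k i : 'I_n) (j : 'I_(n + n)).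
Hypotheses (ik : i != k) (jk : j != lshift n k).

Lemma mutate_pos :
  0 < b M i k -> 0 <= M k j -> mutate M k i j = M i j + b M i k * M k j.
Proof.
rewrite mxE (negPf ik) (negPf jk) /= => x0 y0.
by rewrite gtr0_sg // mul1r max_l // mulr_ge0 // ltW.
Qed.

Lemma mutate_neg :
  b M i k < 0 -> M k j <= 0 -> mutate M k i j = M i j - b M i k * M k j.
Proof.
rewrite mxE (negPf ik) (negPf jk) /= => x0 y0.
by rewrite ltr0_sg // mulN1r max_l // mulr_le0 // ltW.
Qed.

Lemma mutate_id : b M i k * M k j <= 0 -> mutate M k i j = M i j.
Proof.
by rewrite mxE (negPf ik) (negPf jk) /= => xy; rewrite max_r // mulr0 addr0.
Qed.

End Away.

(* In an abundant quiver, acyclicity is the absence of oriented triangles; a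
   fork minus its point of return is acyclic. *)
Record forklike M r : Prop := Forklike {
  fork_skew : forall i j, b M j i = - b M i j;
  fork_abundant : forall i j, i != j -> (2 <= b M i j) || (b M i j <= -2);
  fork_return : forall i j, 0 < b M i r -> 0 < b M r j ->
    b M i r < b M j i /\ b M r j < b M j i;
  fork_triangle : forall i j l, i != r -> j != r -> l != r ->
    0 < b M i j -> 0 < b M j l -> 0 < b M l i -> False }.

Lemma is_fork_forklike B r : is_fork B r -> forklike (row_mx B 1%:M) r.
Proof.
case=> qB abB _ retB [inB outB].
have skewB i j : B j i = - B i j by move/matrixP/(_ i j): qB; rewrite !mxE.
have nz i j : i != j -> 0 < B i j \/ 0 < B j i.
  by move=> /abB; rewrite (skewB i j); lia.
split=> [i j|i j|i j|i j l]; rewrite ?row_mxEl //.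
- by move/abB; lia.
- by move=> ir rj; apply: retB; rewrite inE.
move=> ir jr lr ij jl li.
(* If r -> y instead, the return inequality for x -> r -> y would give y -> x. So a triangle
   avoiding r that meets the in-neighbours of r lies among them; otherwise it lies among the
   out-neighbours. Both sets are acyclic. *)
have stay x y : y != r -> 0 < B x y -> 0 < B x r -> 0 < B y r.
  move=> yr xy xr; case: (nz y r yr) => // ry.
  have [] := retB x y; rewrite ?inE //.
  by move: xy; rewrite (skewB x y) /has_arrow in xr *; lia.
have tri (S : {set 'I_n}) : i \in S -> j \in S -> l \in S -> acyclic_on B S -> False.
  move=> iS jS lS /(_ [:: i; j; l] isT); rewrite /= /has_arrow ij jl li => H.
  suff /H : {subset [:: i; j; l] <= S} by [].
  by move=> x; rewrite !inE => /or3P[] /eqP->.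
case: (nz i r ir) => [ir'|ri].
  have jr' := stay i j jr ij ir'; have lr' := stay j l lr jl jr'.
  by apply: (tri (in_nbrs B r)); rewrite ?inE.
apply: (tri (out_nbrs B r)); rewrite ?inE //.
  case: (nz j r jr) => // jr'; have lr' := stay j l lr jl jr'.
  by have := stay l i ir li lr'; rewrite (skewB r i); lia.
case: (nz l r lr) => // lr'.
by have := stay l i ir li lr'; rewrite (skewB r i); lia.
Qed.

Lemma forklike_loop M r i : forklike M r -> b M i i = 0.
Proof. by move=> F; have := fork_skew F i i; lia. Qed.

(** * Forks under mutation away from the point of return *)

Lemma lshift_neq j k : j != k -> lshift n j != lshift n k.
Proof. by apply: contra => /eqP/lshift_inj->. Qed.

(** The case to check is j -> i. Then i -> k -> j -> i is an oriented triangle, so r is i or j, and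
    the return inequalities put [b M j i] and one path arrow below the other path arrow. As both
    path arrows are at least 2, the product minus [b M j i] exceeds each of them. *)
Lemma mutate_path M r k i j : forklike M r -> k != r ->
    0 < b M i k -> 0 < b M k j ->
  [/\ mutate M k i (lshift n j) = b M i j + b M i k * b M k j,
      b M i k < mutate M k i (lshift n j) &
      b M k j < mutate M k i (lshift n j)].
Proof.
move=> F kr ik kj.
have ik' : i != k by apply: contraTneq ik => ->; rewrite (forklike_loop _ F).
have jk' : j != k by apply: contraTneq kj => ->; rewrite (forklike_loop _ F).
have sk := fork_skew F.
have ij' : i != j by apply: contraTneq kj => <-; rewrite (sk i k); lia.
rewrite (mutate_pos ik' (lshift_neq jk') ik (ltW kj)).
have := fork_abundant F ij'.
have := fork_abundant F ik'; have := fork_abundant F jk'.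
have kjE := sk k j.
case/orP=> [|kj2]; first lia.
case/orP=> [ik2|]; last lia.
case/orP=> [ij2|ji2]; first by split=> //; nia.
have ji : 0 < b M j i by rewrite sk; lia.
have [ir|ir] := eqVneq i r.
  subst i; have [] := fork_return F ji ik.
  by move=> ? ?; have := sk r j; split=> //; nia.
have [jr|jr] := eqVneq j r.
  subst j; have [] := fork_return F kj ji.
  by move=> ? ?; have := sk r i; split=> //; nia.
by have := fork_triangle F ir kr jr ik kj ji.
Qed.

Lemma mutate_path_skew M r k i j : forklike M r -> k != r ->
    0 < b M i k -> 0 < b M k j ->
  mutate M k j (lshift n i) = - mutate M k i (lshift n j).
Proof.
move=> F kr ik kj; have sk := fork_skew F.
have ik' : i != k by apply: contraTneq ik => ->; rewrite (forklike_loop _ F).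
have jk' : j != k by apply: contraTneq kj => ->; rewrite (forklike_loop _ F).
have ki : b M k i < 0 by rewrite (sk i k); lia.
have jk : b M j k < 0 by rewrite (sk k j); lia.
have [-> _ _] := mutate_path F kr ik kj.
rewrite (mutate_neg jk' (lshift_neq ik') jk (ltW ki)) (sk i j) (sk k j) (sk i k).
by lia.
Qed.

Lemma mutate_nopath M k i j : i != k -> j != k ->
  (0 < b M i k) != (0 < b M k j) -> mutate M k i (lshift n j) = b M i j.
Proof.
move=> ik jk H; rewrite (mutate_id ik (lshift_neq jk)) //; move: H.
case: (ltP 0 (b M i k)) => ik0; case: (ltP 0 (b M k j)) => // kj0 _.
  by rewrite mulr_ge0_le0 // ltW.
by rewrite mulr_le0_ge0 // ltW.
Qed.

Lemma fork_total M r i j : forklike M r -> i != j -> (b M j i <= 0) = (0 < b M i j).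
Proof. by move=> F /(fork_abundant F); rewrite (fork_skew F i j); lia. Qed.

(** In the third case k is a source or a sink with respect to i and j, and mutation at k leaves the
    entry between them alone. *)
Lemma fork_path_cases M r k i j : forklike M r -> i != k -> j != k ->
  [\/ 0 < b M i k /\ 0 < b M k j, 0 < b M j k /\ 0 < b M k i
    | (0 < b M i k) != (0 < b M k j)].
Proof.
move=> F ik jk; have [|H] := boolP (_ != _); first by constructor 3.
case: (ltP 0 (b M i k)) H => [ik0 /negPn/eqP/esym kj0|ik0].
  by constructor 1.
case: (ltP 0 (b M k j)) => // kj0 _; constructor 2.
by rewrite -(fork_total F jk) -(fork_total F) // eq_sym.
Qed.

(** The right-hand side reads only signs of old entries, so forks with equal signs keep equal
    signs. *)
Lemma mutate_sg M r k i j : forklike M r -> k != r ->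
  Num.sg (mutate M k i (lshift n j)) =
    if (i == k) || (j == k) then - Num.sg (b M i j) else
    if (0 < b M i k) != (0 < b M k j) then Num.sg (b M i j) else
    if 0 < b M i k then 1 else -1.
Proof.
move=> F kr; case: ifPn => [ijk|/norP[ik jk]].
  by rewrite mutate_at ?sgrN // (inj_eq (@lshift_inj _ _)).
case: (fork_path_cases F ik jk) => [[ik0 kj0]|[jk0 ki0]|H].
- have [_ ? _] := mutate_path F kr ik0 kj0.
  by rewrite ik0 kj0 gtr0_sg //; apply: lt_trans ik0 _.
- have [_ ? _] := mutate_path F kr jk0 ki0.
  rewrite (mutate_path_skew F kr jk0 ki0) sgrN.
  rewrite -(fork_total F ik) leNgt ki0 -(fork_total F) 1?eq_sym // leNgt jk0 /=.
  by rewrite gtr0_sg //; apply: lt_trans jk0 _.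
by rewrite H mutate_nopath.
Qed.

Lemma forklike_mutate M r k :
  forklike M r -> k != r -> forklike (mutate M k) k.
Proof.
move=> F kr; have sk := fork_skew F.
have atE i j : (i == k) || (j == k) -> b (mutate M k) i j = - b M i j.
  by move=> ijk; rewrite mutate_at // (inj_eq (@lshift_inj _ _)).
have skew' i j : b (mutate M k) j i = - b (mutate M k) i j.
  have [ijk|/norP[ik jk]] := boolP ((i == k) || (j == k)).
    by rewrite !atE // 1?orbC // (sk i j).
  case: (fork_path_cases F ik jk) => [[ik0 kj0]|[jk0 ki0]|H].
  - exact: mutate_path_skew F kr ik0 kj0.
  - by rewrite (mutate_path_skew F kr jk0 ki0) opprK.
  rewrite !mutate_nopath // -(fork_total F jk) -(fork_total F (i := k)) 1?eq_sym //.
  by rewrite !leNgt (inj_eq negb_inj).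
split=> // [i j ij|i j|].
- have [ijk|/norP[ik jk]] := boolP ((i == k) || (j == k)).
    by rewrite atE //; have := fork_abundant F ij; lia.
  case: (fork_path_cases F ik jk) => [[ik0 kj0]|[jk0 ki0]|H].
  + have [_ ? _] := mutate_path F kr ik0 kj0.
    by have := fork_abundant F ik; lia.
  + have [_ ? _] := mutate_path F kr jk0 ki0.
    by rewrite skew'; have := fork_abundant F jk; lia.
  by rewrite mutate_nopath // (fork_abundant F).
- rewrite (atE i k) ?eqxx ?orbT // (atE k j) ?eqxx // -!sk => ki jk.
  by have [_ ? ?] := mutate_path F kr jk ki; have := sk j k; have := sk k i; lia.
(* Every arrow between the neighbours of k on both sides now goes from in(k) to
   out(k), so a triangle avoiding k stays on one side, where M is unchanged. *)
have arrow i j : i != k -> j != k -> 0 < b (mutate M k) i j ->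
    (0 < b M j k -> 0 < b M i k) /\
    ((0 < b M i k) = (0 < b M j k) -> 0 < b M i j).
  move=> ik jk.
  have [E|] := boolP ((0 < b M i k) == (0 < b M j k)).
    rewrite mutate_nopath ?(eqP E) //.
    by rewrite (sk j k) -(fork_total F (i := j)) // (sk j k); case: ltgtP => //; lia.
  move=> H ij; split=> [jk0|/eqP]; last by rewrite (negPf H).
  apply/negPn/negP=> ik0.
  have ki : 0 < b M k i by rewrite -(fork_total F) 1?eq_sym // leNgt.
  by have [_ ? _] := mutate_path F kr jk0 ki; have := skew' i j; lia.
(* If k -> r, the return inequality for k -> r -> x gives x -> k; if r -> k, the one for y -> r -> k
   gives k -> y. Either way r and another corner of the triangle are on different sides of k. *)
have noR x y : x != k -> y != k -> (0 < b M x k) = (0 < b M y k) ->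
    0 < b M r x -> 0 < b M x y -> 0 < b M y r ->
    (0 < b M r k) = (0 < b M x k) -> False.
  move=> xk yk xyk rx xy yr rxk.
  have [k_r|] := ltP 0 (b M k r); last rewrite (fork_total F) 1?eq_sym // => rk.
    have [H _] := fork_return F k_r rx.
    by move: rxk; have := sk k r; have := sk k x; lia.
  have [H _] := fork_return F yr rk.
  by move: rxk xyk; have := sk y k; lia.
move=> i j l ik jk lk ij jl li.
have [i1 i2] := arrow i j ik jk ij; have [j1 j2] := arrow j l jk lk jl.
have [l1 l2] := arrow l i lk ik li.
have eij : (0 < b M i k) = (0 < b M j k).
  by apply/idP/idP => // ?; apply: j1; apply: l1.
have ejl : (0 < b M j k) = (0 < b M l k).
  by apply/idP/idP => // ?; apply: l1; apply: i1.
move: (i2 eij) (j2 ejl) (l2 (esym (etrans eij ejl))) => {ij jl li} ij jl li.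
have [ir|ir] := eqVneq i r; first by subst i; apply: (noR j l).
have [jr|jr] := eqVneq j r; first by subst j; apply: (noR l i); rewrite // -?ejl.
have [lr|lr] := eqVneq l r.
  by subst l; apply: (noR i j); rewrite // eij.
exact: (fork_triangle F ir jr lr).
Qed.

(** * Colours of the c-vectors *)

(** Here [e i] is the predicted colour of c_i, with [true] for green. Nonnegativity of [cabs] is
    then sign-coherence, which the induction proves instead of assuming it. *)
Definition cabs M e i l : int := if e i then c M i l else - c M i l.

(* [b i k * c_k > 0], when [c_k] has the sign given by [e k] *)
Definition aligned M e i k : bool := if e k then 0 < b M i k else b M i k < 0.

(** The new colours depend only on [e] and on signs of the quiver, so they can be shared by two
    forks. *)
Definition recolor M e k i : bool :=
  if i == k then ~~ e k else if aligned M e i k then e k else e i.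

(* In [coh_return], the first disjunct covers the initial seed, before any
   mutation at [r]. *)
Record coherent M r e : Prop := Coherent {
  coh_ge0 : forall i l, 0 <= cabs M e i l;
  coh_neq0 : forall i, exists l, 0 < cabs M e i l;
  coh_arrow : forall i j, i != r -> j != r -> 0 < b M i j -> e j -> e i;
  coh_return : (forall i, e i) \/ forall i, aligned M e i r ->
    e i = ~~ e r /\ forall l, cabs M e r l <= cabs M e i l }.

Lemma coherent_init B r :
  coherent (row_mx B 1%:M) r (fun=> true).
Proof.
split=> [i l|i|//|]; last by left.
  by rewrite /cabs row_mxEr mxE; case: (i == l).
by exists i; rewrite /cabs row_mxEr mxE eqxx.
Qed.

Lemma rshift_neq_lshift j k : rshift n j != lshift n k.
Proof. by rewrite eq_sym eq_lrshift. Qed.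

Lemma cabs_mutate_at M e k l : cabs (mutate M k) (recolor M e k) k l = cabs M e k l.
Proof.
by rewrite /cabs /recolor eqxx mutate_at ?eqxx //; case: (e k); rewrite ?opprK.
Qed.

Section Step.

Variables (M : 'M[int]_(n, n + n)) (r k : 'I_n) (e : 'I_n -> bool).
Hypotheses (F : forklike M r) (C : coherent M r e) (kr : k != r).

Lemma cabs_mutate_id i l : i != k -> ~~ aligned M e i k ->
  cabs (mutate M k) (recolor M e k) i l = cabs M e i l.
Proof.
move=> ik na; rewrite /cabs /recolor (negPf ik) (negPf na).
rewrite (mutate_id ik (rshift_neq_lshift l k)) //.
move: na (coh_ge0 C k l); rewrite /aligned /cabs.
by case: (e k) => ? ?; nia.
Qed.

Lemma mutate_aligned i l : i != k -> aligned M e i k ->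
  c (mutate M k) i l = c M i l + `|b M i k| * c M k l.
Proof.
move=> ik; have := coh_ge0 C k l; rewrite /aligned /cabs.
case: (e k) => ck ik0.
  by rewrite (mutate_pos ik (rshift_neq_lshift l k) ik0 ck) gtr0_norm.
by rewrite (mutate_neg ik (rshift_neq_lshift l k) ik0) ?ltr0_norm ?mulNr //; lia.
Qed.

(** Equal colours add up; opposite colours leave at least 2 |c_k| - |c_r| >= |c_k|. The bound fixes
    the sign of the new c_i and also supplies the domination required at the new point of return
    k. *)
Lemma cabs_le_aligned i l : i != k -> aligned M e i k ->
  cabs M e k l <= cabs (mutate M k) (recolor M e k) i l.
Proof.
move=> ik al; have := coh_ge0 C k l; have := coh_ge0 C i l.
have al2 : 2 <= `|b M i k| by have := fork_abundant F ik; lia.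
rewrite {2 4}/cabs /recolor (negPf ik) al mutate_aligned //.
have [eik|eik] := boolP (e i == e k).
  by rewrite /cabs (eqP eik); case: (e k) => ? ?; nia.
(* Otherwise the arrow between i and k would avoid r and run from red to green. *)
have ir : i = r.
  apply/eqP/negPn/negP => ir; move: al eik; rewrite /aligned.
  case ek: (e k) => ik0.
    by rewrite (coh_arrow C ir kr ik0 ek).
  case ei: (e i) => // _.
  have ki : 0 < b M k i by rewrite (fork_skew F i k); lia.
  by rewrite (coh_arrow C kr ir ki ei) in ek.
subst i; case: (coh_return C) => [all|dom]; first by rewrite !all in eik.
(* The colours of k and r differ and b is skew: the two sign changes cancel. *)
have /dom[_ /(_ l)] : aligned M e k r.
  move: al eik; rewrite /aligned (fork_skew F k r).
  by case: (e k); case: (e r) => //; lia.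
move: eik; rewrite /cabs; case: (e k); case: (e r) => // _ ? ? ?; nia.
Qed.

Lemma coherent_mutate : coherent (mutate M k) k (recolor M e k).
Proof.
have sk := fork_skew F.
split=> [i l|i|i j ik jk|].
- have [->|ik] := eqVneq i k; first by rewrite cabs_mutate_at (coh_ge0 C).
  have [al|na] := boolP (aligned M e i k).
    exact: le_trans (coh_ge0 C k l) (cabs_le_aligned _ ik al).
  by rewrite cabs_mutate_id ?(coh_ge0 C).
- have [->|ik] := eqVneq i k.
    by have [l ?] := coh_neq0 C k; exists l; rewrite cabs_mutate_at.
  have [al|na] := boolP (aligned M e i k).
    have [l kl] := coh_neq0 C k; exists l.
    exact: lt_le_trans kl (cabs_le_aligned _ ik al).
  by have [l ?] := coh_neq0 C i; exists l; rewrite cabs_mutate_id.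
- case: (fork_path_cases F ik jk) => [[ik0 kj0]|[jk0 ki0]|H].
  (* A green k makes i green, and a red k makes j red. *)
  + have jk0 : b M j k < 0 by rewrite (sk k j); lia.
    rewrite /recolor /aligned (negPf ik) (negPf jk) ik0 jk0.
    by case: (e k) => //; case: ifP.
  + rewrite (mutate_path_skew F kr jk0 ki0).
    by have [_ ? _] := mutate_path F kr jk0 ki0; lia.
  rewrite mutate_nopath // /recolor (negPf ik) (negPf jk) => ij.
  have same : aligned M e i k = aligned M e j k.
    move: H; have := fork_abundant F ik; have := fork_abundant F jk.
    by rewrite /aligned (sk j k); case: (e k); lia.
  rewrite same; case: ifP => // /negbT na ej.
  have ni : ~~ aligned M e i k by rewrite same.
  case: (coh_return C) => [//|dom].
  (* [coh_arrow] does not cover arrows at r. According to the colour of k, either [fork_return]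
     aligns the other end with k, or k is aligned with r and [coh_return] gives it the colour
     opposite to r; both are contradictory. *)
  have [ir|ir] := eqVneq i r.
    subst i; apply: contraT => er.
    have [ek|ek] := boolP (e k).
      have kr0 : 0 < b M k r.
        by move: ni; rewrite /aligned ek -leNgt (fork_total F).
      have [] := fork_return F kr0 ij.
      by move: na; rewrite /aligned ek (sk j r) (sk r j); lia.
    have [] := dom k; last by rewrite (negPf er) (negPf ek).
    move: ni; rewrite /aligned (negPf er) (negPf ek) (sk r k).
    by have := fork_abundant F ik; lia.
  have [jr|jr] := eqVneq j r; last exact: (coh_arrow C ir jr ij ej).
  subst j; have [ek|ek] := boolP (e k).
    have [] := dom k; last by rewrite ej ek.
    by move: na; rewrite /aligned ej ek -leNgt (fork_total F).
  have rk0 : 0 < b M r k.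
    by move: na; rewrite /aligned (negPf ek); have := fork_abundant F jk; lia.
  have [] := fork_return F ij rk0.
  by move: ni; rewrite /aligned (negPf ek) (sk i k); lia.
right=> i; rewrite /aligned {1}/recolor eqxx.
have [->|ik al'] := eqVneq i k.
  rewrite (forklike_loop _ (forklike_mutate F kr)) ltxx.
  by case: (~~ _).
(* Mutation flips both the colour of k and the entry at (i, k), so alignment with k is unchanged. *)
have al : aligned M e i k.
  move: al'; rewrite mutate_at ?eqxx ?orbT // /aligned.
  by case: (e k) => /=; lia.
split=> [|l]; last by rewrite cabs_mutate_at cabs_le_aligned.
by rewrite /recolor (negPf ik) al eqxx negbK.
Qed.

End Step.

(** * From colours to reflections *)

(** A nonzero entry of c_k, whose sign is given by [e k], reveals the sign of [b M i k]; this turns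
    the test in the recursion into one on signs and colours. *)
Lemma pos_vec_aligned M e i k : (forall l, 0 <= cabs M e k l) ->
  (exists l, 0 < cabs M e k l) ->
  pos_vec (b M i k *: row k (rsubmx M)) = aligned M e i k.
Proof.
move=> ge0 [l kl]; rewrite /pos_vec /aligned; apply/andP/idP.
  case=> nz /forallP/(_ l) pl.
  have {nz} b0 : b M i k != 0 by apply: contraNneq nz => ->; rewrite scale0r.
  by move: pl kl; rewrite !mxE /cabs; case: (e k); nia.
move=> al; split.
  apply/eqP=> /matrixP/(_ 0 l); move: al kl; rewrite !mxE /cabs.
  by case: (e k); nia.
apply/forallP=> j; rewrite !mxE; move: al (ge0 j); rewrite /cabs.
by case: (e k); nia.
Qed.

End ForkMutation.

Theorem corollary1p9 (n : nat) (n_gt0 : (0 < n)%N)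
    (B B' : 'M[int]_n) (r r' : 'I_n) (w : seq 'I_n)
    (forkB : is_fork B r) (forkB' : is_fork B' r')
    (sgBB' : forall i j, Num.sg (B i j) = Num.sg (B' i j))
    (wB : fork_preserving r w) (wB' : fork_preserving r' w) :
  reflections B w = reflections B' w.
Proof.
(* A single colouring [e] serves both forks. The current point of return [last r w] is the last
   mutated vertex, or r at the start. *)
suff [e [_ _ _ _ [_ eqr]]] : exists e,
    [/\ forklike (framed B w) (last r w), coherent (framed B w) (last r w) e,
       forklike (framed B' w) (last r' w),
       coherent (framed B' w) (last r' w) e &
       (forall i j, Num.sg (framed B w i (lshift n j)) =
                    Num.sg (framed B' w i (lshift n j))) /\
       reflection B w =1 reflection B' w].
  by apply: eq_from_tnth => i; rewrite !tnth_mktuple.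
elim/last_ind: w wB wB' => [_ _|w k IHw].
  exists (fun=> true); split; try exact: is_fork_forklike; try exact: coherent_init.
  by split=> [i j|i]; rewrite ?row_mxEl.
(* The next mutation avoids the current point of return: by the condition on the first letter if [w]
   is empty, by reducedness otherwise. *)
have fp x : fork_preserving x (rcons w k) -> fork_preserving x w /\ k != last x w.
  rewrite /fork_preserving /reduced; case: w {IHw} => [|a w] /=.
    by move=> H; split=> //; apply: contraNneq H => ->.
  by rewrite rcons_path => /andP[/andP[-> ?] ->]; rewrite eq_sym.
move=> /fp[wB kr] /fp[wB' kr'].
have {IHw} [e [F C F' C' [sg eqr]]] := IHw wB wB'.
have gtE i j : (0 < framed B w i (lshift n j)) = (0 < framed B' w i (lshift n j)).
  by rewrite -sgr_gt0 sg sgr_gt0.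
have ltE i j : (framed B w i (lshift n j) < 0) = (framed B' w i (lshift n j) < 0).
  by rewrite -sgr_lt0 sg sgr_lt0.
have alE i : aligned (framed B w) e i k = aligned (framed B' w) e i k.
  by rewrite /aligned gtE ltE.
have recE : recolor (framed B' w) e k =1 recolor (framed B w) e k.
  by move=> i; rewrite /recolor alE.
exists (recolor (framed B w) e k); rewrite !last_rcons /framed !foldl_rcons.
split; try exact: forklike_mutate F kr; try exact: forklike_mutate F' kr'.
- exact: coherent_mutate F C kr.
(* Coherence for B' comes with the colouring computed from B'; it is carried over field by field,
   since the two colourings agree pointwise. *)
- case: (coherent_mutate F' C' kr') => c1 c2 c3 c4; split.
  + by move=> i l; rewrite /cabs -recE; apply: c1.
  + by move=> i; have [l] := c2 i; rewrite /cabs recE => ?; exists l.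
  + by move=> i j ik jk ij; rewrite -!recE; apply: c3.
  case: c4 => [c4|c4]; [left|right] => i; first by rewrite -recE.
  by have := c4 i; rewrite /aligned /cabs !recE.
split=> [i j|i]; first by rewrite (mutate_sg _ _ F kr) (mutate_sg _ _ F' kr') !gtE !sg.
rewrite !reflection_rcons !eqr /cvec /Cmut /Bmut ![lsubmx _ _ _]mxE.
rewrite (pos_vec_aligned _ (coh_ge0 C k) (coh_neq0 C k)).
by rewrite (pos_vec_aligned _ (coh_ge0 C' k) (coh_neq0 C' k)) alE.
Qed.
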